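(* Let $(\mathbf Y,d)$ be a Polish metric space with $d\le 1$, $S$ a countable dense subset of $\mathbf Y$, and $L$ a countable continuous signature all of whose symbols have continuity modulus $\mathsf{id}$. Then the subset $\mathcal{SC}_S\subset\mathbf Y_L$ is $\mathsf{Iso}(S)$-invariant and Borel.
   Context: $L$ is a countable continuous signature with metric symbol $d$, predicate symbols $R_i$ and function symbols $F_j$. An $L$-structure on $\mathbf Y$ interprets $d$ as the metric of $\mathbf Y$, predicates as maps $\mathbf Y^n\to[0,1]$ and function symbols as maps $\mathbf Y^n\to\mathbf Y$; having continuity modulus $\mathsf{id}$ means these maps are $1$-Lipschitz in each variable separately. Formulas are built from $0,1$ and atomic formulas ($R_i(t_1,\dots,t_r)$, $d(t_1,t_2)$, with $t_i$ terms) by the connectives $x/2$, $x\dot-y=\max(x-y,0)$, $\min$, $\max$, $|x-y|$, $1-x$, $\min(x+y,1)$, truncated multiplication by positive rationals, and the quantifiers $\sup_x,\inf_x$; $\phi^M(\bar a)\in[0,1]$ denotes the value of $\phi$ at $\bar a$ in $M$. $\mathbf Y_L$ is the set of all $L$-structures on $\mathbf Y$ with the Polish topology that is the coarsest one making all maps $M\mapsto R_i^M(\bar s)\in[0,1]$ and $M\mapsto F_j^M(\bar s)\in\mathbf Y$ continuous, for tuples $\bar s$ from $S$. The isometry group $\mathsf{Iso}(\mathbf Y)$ acts on $\mathbf Y_L$ by transport of structure, and $\mathsf{Iso}(S)$ is the group of isometries of $\mathbf Y$ stabilizing $S$ setwise. $\mathcal{SC}_S$ is the set of all $L$-structures $M$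 on $\mathbf Y$ satisfying the following: for every $n$ and every rational $\varepsilon>0$ there are a finite set $F=\{\bar a_i:i\in I\}$ of $n$-tuples from $S$ and conditions $\phi_i(\bar x)\le\delta_i$ ($i\in I$, $I$ finite, $\phi_i$ an $L$-formula with $|\bar x|=n$, $\delta_i$ rational) with $\phi_i^M(\bar a_i)\le\delta_i$ for all $i\in I$, such that (1) every $n$-tuple $\bar a$ from $S$ satisfies in $M$ at least one of the conditions $\phi_i(\bar x)\le\delta_i$; and (2) whenever $i\in I$, $\bar a=(a_1,\dots,a_n)$ is an $n$-tuple from $S$ with $\phi_i^M(\bar a)\le\delta_i$, and $\bar c$ is an $(n+1)$-tuple from $S$ with $\phi_i^M(c_1,\dots,c_n)\le\delta_i$, then for every finite set $\Delta$ of $L$-formulas $\phi(\bar y)$, $|\bar y|=n+1$, with $\phi^M(\bar c)=0$ for all $\phi\in\Delta$, there is an $(n+1)$-tuple $\bar b=(b_1,\dots,b_{n+1})$ from $S$ with $\max_{j\le n}d(a_j,b_j)\le\varepsilon$ and $\phi^M(\bar b)=0$ for all $\phi\in\Delta$. *)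

(* Defs.v *)
From HB Require Import structures.
From mathcomp Require Import all_boot all_order all_algebra.
From mathcomp Require Import all_classical all_reals all_analysis.

Set Implicit Arguments.
Unset Strict Implicit.
Unset Printing Implicit Defensive.

Import Order.TTheory GRing.Theory Num.Theory.
Import numFieldNormedType.Exports.

Local Open Scope classical_set_scope.
Local Open Scope ring_scope.

(* [completeType] is not used, because it forces the space to be pointed. *)
Definition polish_metric (R : realType) (Y : metricType R) : Prop :=
  (exists2 D : set Y, countable D & dense D) /\
  (forall F : set_system Y, ProperFilter F -> cauchy F ->
     exists y : Y, F --> y).

Definition tuples_of (T : Type) (S : set T) (n : nat) : set ('I_n -> T) :=
  [set a | forall i, S (a i)].
Arguments tuples_of {T} S n _ /.

(* An (n+1)-tuple consists of its first n entries, at the indices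
   [lift ord_max j], and of its last entry, at [ord_max]. *)
Definition tinit (T : Type) (n : nat) (c : 'I_n.+1 -> T) : 'I_n -> T :=
  fun j => c (lift ord_max j).

Definition trcons (T : Type) (n : nat) (a : 'I_n -> T) (y : T) :
    'I_n.+1 -> T :=
  fun i => if unlift ord_max i is Some j then a j else y.

(* The metric symbol is not listed: it is built into formulas and always
   interpreted as the metric of the space. All symbols have continuity modulus
   id; this is expressed by the Lipschitz fields of [structure]. *)
Record signature := Signature {
  psym : countType;
  parity : psym -> nat;
  fsym : countType;
  farity : fsym -> nat }.

Inductive term (L : signature) (n : nat) : Type :=
| TVar of 'I_n
| TApp (f : fsym L) of ('I_(farity f) -> term L n).

(* [formula L n] is the type of L-formulas in n free variables; a quantifier
   binds the last variable of its body. *)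
Inductive formula (L : signature) : nat -> Type :=
| FZero n : formula L n
| FOne n : formula L n
| FPred n (P : psym L) of ('I_(parity P) -> term L n) : formula L n
| FDist n of term L n & term L n : formula L n
| FHalf n of formula L n : formula L n
| FMonus n of formula L n & formula L n : formula L n
| FMin n of formula L n & formula L n : formula L n
| FMax n of formula L n & formula L n : formula L n
| FAbsDiff n of formula L n & formula L n : formula L n
| FNeg n of formula L n : formula L n
| FPlus n of formula L n & formula L n : formula L n
| FScale n (q : rat) of 0 < q & formula L n : formula L n
| FSup n of formula L n.+1 : formula L n
| FInf n of formula L n.+1 : formula L n.

Record structure (R : realType) (Y : metricType R) (L : signature) := Structure {
  ipred : forall P : psym L, ('I_(parity P) -> Y) -> R;
  ifun : forall f : fsym L, ('I_(farity f) -> Y) -> Y;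
  ipred01 : forall (P : psym L) (a : 'I_(parity P) -> Y),
    0 <= ipred a <= 1;
  ipred_lip : forall (P : psym L) (i : 'I_(parity P)) (a b : 'I_(parity P) -> Y),
    (forall j, j != i -> a j = b j) ->
    `|ipred a - ipred b| <= mdist (a i) (b i);
  ifun_lip : forall (f : fsym L) (i : 'I_(farity f)) (a b : 'I_(farity f) -> Y),
    (forall j, j != i -> a j = b j) ->
    mdist (ifun a) (ifun b) <= mdist (a i) (b i) }.

HB.instance Definition _ (R : realType) (Y : metricType R) (L : signature) :=
  gen_eqMixin (structure Y L).
HB.instance Definition _ (R : realType) (Y : metricType R) (L : signature) :=
  gen_choiceMixin (structure Y L).

Section semantics.
Context {R : realType} {Y : metricType R} {L : signature}.
Variable M : structure Y L.

Fixpoint teval (n : nat) (t : term L n) (a : 'I_n -> Y) : Y :=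
  match t with
  | TVar i => a i
  | TApp f u => ifun M (fun j : 'I_(farity f) => teval (u j) a)
  end.

Fixpoint feval (n : nat) (phi : formula L n) : ('I_n -> Y) -> R :=
  match phi in formula _ n return ('I_n -> Y) -> R with
  | FZero _ => fun=> 0
  | FOne _ => fun=> 1
  | FPred _ P u => fun a => ipred M (fun j : 'I_(parity P) => teval (u j) a)
  | FDist _ t u => fun a => mdist (teval t a) (teval u a)
  | FHalf _ p => fun a => feval p a / 2
  | FMonus _ p q => fun a => Num.max (feval p a - feval q a) 0
  | FMin _ p q => fun a => Num.min (feval p a) (feval q a)
  | FMax _ p q => fun a => Num.max (feval p a) (feval q a)
  | FAbsDiff _ p q => fun a => `|feval p a - feval q a|
  | FNeg _ p => fun a => 1 - feval p a
  | FPlus _ p q => fun a => Num.min (feval p a + feval q a) 1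
  | FScale _ r _ p => fun a => Num.min (ratr r * feval p a) 1
  | FSup _ p => fun a => sup (range (fun y : Y => feval p (trcons a y)))
  | FInf _ p => fun a => inf (range (fun y : Y => feval p (trcons a y)))
  end.

End semantics.

(* The space Y_L: the coarsest topology on the L-structures that makes
   M |-> P^M(s) and M |-> f^M(s) continuous for all tuples s from S. *)
Section structure_space.
Context {R : realType} {Y : metricType R}.
Variables (L : signature) (S : set Y).

Definition sample : Type :=
  ({P : psym L & tuples_of S (parity P)} +
   {f : fsym L & tuples_of S (farity f)})%type.

Definition sample_topology (s : sample) : Topological (structure Y L) :=
  match s with
  | inl (existT P a) => Topological.class
      (initial_topology (fun M : structure Y L => ipred M (\val a) : R))
  | inr (existT f a) => Topological.class
      (initial_topology (fun M : structure Y L => ifun M (\val a)))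
  end.

Definition structure_space : topologicalType := sup_topology sample_topology.

End structure_space.

Definition borel (T : topologicalType) (A : set T) : Prop := <<s @open T >> A.

Record isometry (R : realType) (Y : metricType R) := Isometry {
  iso : Y -> Y;
  iso_inv : Y -> Y;
  isoK : cancel iso iso_inv;
  iso_invK : cancel iso_inv iso;
  isoP : forall x y, mdist (iso x) (iso y) = mdist x y }.

Section action.
Context {R : realType} {Y : metricType R} {L : signature}.
Variables (g : isometry Y) (M : structure Y L).

Let gpred (P : psym L) (a : 'I_(parity P) -> Y) : R :=
  ipred M (fun i => iso_inv g (a i)).

Let gfun (f : fsym L) (a : 'I_(farity f) -> Y) : Y :=
  iso g (ifun M (fun i => iso_inv g (a i))).

Lemma iso_invP x y : mdist (iso_inv g x) (iso_inv g y) = mdist x y.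
Proof. by rewrite -(isoP g) !iso_invK. Qed.

Lemma gpred01 P (a : 'I_(parity P) -> Y) : 0 <= gpred a <= 1.
Proof. exact: ipred01. Qed.

Lemma gpred_lip P i (a b : 'I_(parity P) -> Y) :
  (forall j, j != i -> a j = b j) -> `|gpred a - gpred b| <= mdist (a i) (b i).
Proof.
by move=> ab; rewrite -[leRHS]iso_invP; apply: ipred_lip => j ji; rewrite ab.
Qed.

Lemma gfun_lip f i (a b : 'I_(farity f) -> Y) :
  (forall j, j != i -> a j = b j) -> mdist (gfun a) (gfun b) <= mdist (a i) (b i).
Proof.
move=> ab; rewrite isoP -[leRHS]iso_invP.
by apply: ifun_lip => j ji; rewrite ab.
Qed.

Definition transport : structure Y L := Structure gpred01 gpred_lip gfun_lip.

End action.

Definition Iso_invariant (R : realType) (Y : metricType R) (L : signature)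
    (S : set Y) (A : set (structure Y L)) : Prop :=
  forall g : isometry Y, iso g @` S = S ->
  forall M : structure Y L, A M <-> A (transport g M).

Definition SC (R : realType) (Y : metricType R) (L : signature) (S : set Y) :
    set (structure_space L S) :=
  [set M : structure Y L | forall (n : nat) (eps : rat), 0 < eps ->
    exists (k : nat) (a_ : 'I_k -> 'I_n -> Y)
           (phi : 'I_k -> formula L n) (delta : 'I_k -> rat),
    [/\ forall i, tuples_of S n (a_ i) /\ feval M (phi i) (a_ i) <= ratr (delta i),
        forall a, tuples_of S n a ->
          exists i, feval M (phi i) a <= ratr (delta i)
      & forall i a c,
          tuples_of S n a -> feval M (phi i) a <= ratr (delta i) ->
          tuples_of S n.+1 c -> feval M (phi i) (tinit c) <= ratr (delta i) ->
          forall Delta : set (formula L n.+1), finite_set Delta ->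
          (forall psi, Delta psi -> feval M psi c = 0) ->
          exists b, [/\ tuples_of S n.+1 b,
            forall j, mdist (a j) (tinit b j) <= ratr eps
            & forall psi, Delta psi -> feval M psi b = 0]]].
Arguments SC {R Y} L S _.

(* Main.v *)
(* Formulas are invariant under isometries, so transporting a structure along an
   isometry preserving [S] transports the witnesses of [SC] as well. For the
   Borel part, there are countably many formulas and countably many tuples from
   [S], so [SC L S] is built by countable unions, countable intersections and
   complements from the sets of structures [M] with [phi^M(a) <= r] or
   [phi^M(a) = 0]. These are Borel: since the symbols are 1-Lipschitz in each
   variable, the values of terms and atomic formulas are continuous in [M] at
   all points of [Y], although the topology only mentions points of [S]; and
   since formulas are Lipschitz in their variables, each quantifier over [Y] can
   be restricted to the countable dense set [S]. *)

Require Import Defs.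
From mathcomp Require Import all_boot all_order all_algebra.
From mathcomp Require Import all_classical all_reals all_analysis.
From mathcomp Require Import measurable_realfun lra.

Set Implicit Arguments.
Unset Strict Implicit.
Unset Printing Implicit Defensive.

Import Order.TTheory GRing.Theory Num.Theory.
Import numFieldNormedType.Exports.

Local Open Scope classical_set_scope.
Local Open Scope ring_scope.

(** * Countability of formulas and of tuples *)

Fixpoint term_code (L : signature) (n : nat) (t : term L n) :
    GenTree.tree nat :=
  match t with
  | TVar i => GenTree.Leaf (i : nat)
  | TApp f u =>
      GenTree.Node (pickle f) [seq term_code (u j) | j <- enum 'I_(farity f)]
  end.

Lemma map_enum_inj (T : Type) (n : nat) (f g : 'I_n -> T) :
  [seq f j | j <- enum 'I_n] = [seq g j | j <- enum 'I_n] -> f =1 g.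
Proof.
move=> fg i; have := congr1 (fun s => nth (f i) s i) fg.
have si : (i < size (enum 'I_n))%N by rewrite size_enum_ord.
by rewrite !(nth_map i _ _ si) nth_ord_enum.
Qed.

Lemma term_code_inj (L : signature) (n : nat) : injective (@term_code L n).
Proof.
move=> t; elim: t => [i|f u IH] [j|g v] //=.
  by case=> /val_inj ->.
(* The type of [v] depends on [g], so the symbols are identified before the arguments are
   compared. *)
case=> /(pcan_inj pickleK) fg; move: v; case: _ / fg => v /map_enum_inj uv.
by congr TApp; apply/funext => j; apply: IH.
Qed.

(** The number [n] of free variables is not recorded, so codes are compared only between formulas
    with equally many variables. The proof of [0 < q] in [FScale] is dropped too, being unique. *)
Fixpoint formula_code (L : signature) (n : nat) (p : formula L n) :
    GenTree.tree nat :=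
  match p with
  | FZero _ => GenTree.Node 0 [::]
  | FOne _ => GenTree.Node 1 [::]
  | FPred _ P u => GenTree.Node 2 (GenTree.Leaf (pickle P) ::
      [seq term_code (u j) | j <- enum 'I_(parity P)])
  | FDist _ t u => GenTree.Node 3 [:: term_code t; term_code u]
  | FHalf _ p => GenTree.Node 4 [:: formula_code p]
  | FMonus _ p q => GenTree.Node 5 [:: formula_code p; formula_code q]
  | FMin _ p q => GenTree.Node 6 [:: formula_code p; formula_code q]
  | FMax _ p q => GenTree.Node 7 [:: formula_code p; formula_code q]
  | FAbsDiff _ p q => GenTree.Node 8 [:: formula_code p; formula_code q]
  | FNeg _ p => GenTree.Node 9 [:: formula_code p]
  | FPlus _ p q => GenTree.Node 10 [:: formula_code p; formula_code q]
  | FScale _ r _ p =>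
      GenTree.Node 11 [:: GenTree.Leaf (pickle r); formula_code p]
  | FSup _ p => GenTree.Node 12 [:: formula_code p]
  | FInf _ p => GenTree.Node 13 [:: formula_code p]
  end.

(* The two arities are kept distinct until after the case analysis on [q], which
   would otherwise be ill-typed. *)
Lemma formula_code_existT (L : signature) (n : nat) (p : formula L n) (m : nat)
    (q : formula L m) : n = m -> formula_code p = formula_code q ->
  existT (formula L) n p = existT (formula L) m q.
Proof.
(* Dependent pairs over [nat] that are equal and share their index have equal second components. *)
have inj := @eq_from_Tagged _ (formula L).
elim: p m q => {n}
  [n|n|n P u|n t u|n p IH|n p IHp q IHq|n p IHp q IHq|n p IHp q IHq
  |n p IHp q IHq|n p IH|n p IHp q IHq|n r r0 p IH|n p IH|n p IH] m [] {m}
  // m.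
(* Different constructors carry different node labels; only the matching pairs remain. *)
all: try by move=> /[swap].
- by move=> ->.
- by move=> ->.
- move=> Q v nm; case: _ / nm v => v [].
  move=> /(pcan_inj pickleK) PQ; move: v; case: _ / PQ => v /map_enum_inj uv.
  by congr existT; congr FPred; apply/funext => j; apply/term_code_inj/uv.
- move=> t' u' nm; case: _ / nm t' u' => t' u' [].
  by move=> /term_code_inj -> /term_code_inj ->.
- by move=> q nm; case: _ / nm q => q [] /(IH _ _ erefl)/inj ->.
- move=> p' q' nm; case: _ / nm p' q' => p' q' [].
  by move=> /(IHp _ _ erefl)/inj -> /(IHq _ _ erefl)/inj ->.
- move=> p' q' nm; case: _ / nm p' q' => p' q' [].
  by move=> /(IHp _ _ erefl)/inj -> /(IHq _ _ erefl)/inj ->.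
- move=> p' q' nm; case: _ / nm p' q' => p' q' [].
  by move=> /(IHp _ _ erefl)/inj -> /(IHq _ _ erefl)/inj ->.
- move=> p' q' nm; case: _ / nm p' q' => p' q' [].
  by move=> /(IHp _ _ erefl)/inj -> /(IHq _ _ erefl)/inj ->.
- by move=> q nm; case: _ / nm q => q [] /(IH _ _ erefl)/inj ->.
- move=> p' q' nm; case: _ / nm p' q' => p' q' [].
  by move=> /(IHp _ _ erefl)/inj -> /(IHq _ _ erefl)/inj ->.
- move=> r' r0' p' nm; case: _ / nm p' => p' [] /(pcan_inj pickleK) rr'.
  move: r0'; case: _ / rr' => r0' /(IH _ _ erefl)/inj ->.
  by congr existT; congr FScale; exact: bool_irrelevance.
- by move=> q nm; case: _ / nm q => q [] /(IH _ _ (congr1 S erefl))/inj ->.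
- by move=> q nm; case: _ / nm q => q [] /(IH _ _ (congr1 S erefl))/inj ->.
Qed.

Lemma countable_formula (L : signature) (n : nat) : countable [set: formula L n].
Proof.
apply/countable_injP; exists (fun p => pickle (formula_code p)) => p q _ _.
move=> /(pcan_inj pickleK) /(formula_code_existT erefl).
exact: (@eq_from_Tagged _ (formula L)).
Qed.

Lemma countable_tuples_of (T : Type) (S : set T) (n : nat) :
  countable S -> countable (tuples_of S n).
Proof.
move=> /countable_injP[f finj]; apply/countable_injP.
exists (fun a => pickle [seq f (a j) | j <- enum 'I_n]) => a b.
move=> /set_mem Sa /set_mem Sb /(pcan_inj pickleK) /map_enum_inj fab.
by apply/funext => j; apply: (finj _ _ _ _ (fab j)); apply/mem_set.
Qed.

(** * Invariance under isometries *)

Lemma teval_transport (R : realType) (Y : metricType R) (L : signature)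
    (g : Defs.isometry Y) (M : structure Y L) (n : nat) (t : term L n)
    (a : 'I_n -> Y) :
  teval (transport g M) t (iso g \o a) = iso g (teval M t a).
Proof.
elim: t => [//|f u IH] /=; congr (iso g (ifun M _)).
by apply/funext => j; rewrite IH isoK.
Qed.

Lemma trcons_comp (T U : Type) (h : T -> U) (n : nat) (a : 'I_n -> T) (y : T) :
  trcons (h \o a) (h y) = h \o trcons a y.
Proof. by apply/funext => i; rewrite /trcons /=; case: unlift. Qed.

Lemma feval_transport (R : realType) (Y : metricType R) (L : signature)
    (g : Defs.isometry Y) (M : structure Y L) (n : nat) (p : formula L n)
    (a : 'I_n -> Y) :
  feval (transport g M) p (iso g \o a) = feval M p a.
Proof.
(* As [iso g] is onto, a quantifier sees the same set of values in [M] and in [transport g M]. *)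
have range_iso m (h : ('I_m.+1 -> Y) -> R) (k : ('I_m.+1 -> Y) -> R) b :
    (forall c, h (iso g \o c) = k c) ->
    range (fun y => h (trcons (iso g \o b) y)) = range (fun y => k (trcons b y)).
  move=> hk; apply/seteqP; split=> _ [y _ <-].
    by exists (iso_inv g y) => //; rewrite -hk -trcons_comp iso_invK.
  by exists (iso g y) => //; rewrite trcons_comp hk.
elim: p a => {n} //=.
- move=> n P u a; congr (ipred M _).
  by apply/funext => j; rewrite teval_transport isoK.
- by move=> n t u a; rewrite !teval_transport isoP.
- by move=> n p IH a; rewrite IH.
- by move=> n p IHp q IHq a; rewrite IHp IHq.
- by move=> n p IHp q IHq a; rewrite IHp IHq.
- by move=> n p IHp q IHq a; rewrite IHp IHq.
- by move=> n p IHp q IHq a; rewrite IHp IHq.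
- by move=> n p IH a; rewrite IH.
- by move=> n p IHp q IHq a; rewrite IHp IHq.
- by move=> n r r0 p IH a; rewrite IH.
- by move=> n p IH a; congr sup; apply: range_iso.
- by move=> n p IH a; congr inf; apply: range_iso.
Qed.

(** The formulas and thresholds witnessing [SC] for [M] are kept, and the tuples are moved by [h];
    test tuples for [N] are pulled back by [k]. With [h] and [k] abstract, both directions of the
    invariance are instances. *)
Lemma SC_transfer (R : realType) (Y : metricType R) (L : signature) (S : set Y)
    (M N : structure Y L) (h k : Y -> Y) :
  cancel k h -> (forall x y, mdist (h x) (h y) = mdist x y) ->
  (forall x, S x -> S (h x)) -> (forall x, S x -> S (k x)) ->
  (forall n (p : formula L n) a, feval N p (h \o a) = feval M p a) ->
  SC L S M -> SC L S N.
Proof.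
move=> kK hP Sh Sk NM MS n eps eps0.
have feval_k m (p : formula L m) a : feval M p (k \o a) = feval N p a.
  by rewrite -NM; congr feval; apply/funext => i /=; rewrite kK.
have [m [a_ [phi [delta [phia cover ext]]]]] := MS n eps eps0.
exists m, (fun i => h \o a_ i), phi, delta; split.
- by move=> i; rewrite NM; split=> [j|]; [apply/Sh; case: (phia i)|case: (phia i)].
- move=> a Sa; have [|i] := cover (k \o a); first by move=> j; apply/Sk/Sa.
  by rewrite feval_k; exists i.
- move=> i a c Sa phiia Sc phiic Delta finD Dc.
  have [||||//||b [Sb ab Db]] := ext i (k \o a) (k \o c) _ _ _ _ Delta.
  + by move=> j; apply/Sk/Sa.
  + by rewrite feval_k.
  + by move=> j; apply/Sk/Sc.
  (* [tinit (k \o c)] and [k \o tinit c] are convertible. *)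
  + by rewrite -feval_k in phiic.
  + by move=> psi Dpsi; rewrite feval_k Dc.
  exists (h \o b); split.
  + by move=> j; apply/Sh/Sb.
  + by move=> j; rewrite -(kK (a j)) hP; exact: ab.
  + by move=> psi Dpsi; rewrite NM Db.
Qed.

Lemma SC_Iso_invariant (R : realType) (Y : metricType R) (L : signature)
    (S : set Y) : Iso_invariant S (SC L S).
Proof.
move=> g gS M.
have Sg x : S x -> S (iso g x) by move=> Sx; rewrite -gS; exists x.
have Sg' x : S x -> S (iso_inv g x).
  by rewrite -{1}gS => -[y Sy <-]; rewrite isoK.
split; first exact: SC_transfer (@iso_invK _ _ g) (@isoP _ _ g) Sg Sg'
  (@feval_transport _ _ _ g M).
apply: (SC_transfer (@isoK _ _ g) (iso_invP g) Sg' Sg) => n p a.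
by rewrite -(feval_transport g); congr feval; apply/funext => i /=; rewrite iso_invK.
Qed.

(** * Lipschitz bounds for symbols and terms *)

Lemma coordinatewise_lipschitz (R : realType) (Y : metricType R) (Z : Type)
    (D : Z -> Z -> R) (n : nat) (F : ('I_n -> Y) -> Z) :
  (forall x, D x x = 0) -> (forall x y z, D x z <= D x y + D y z) ->
  (forall i a b, (forall j, j != i -> a j = b j) ->
    D (F a) (F b) <= mdist (a i) (b i)) ->
  forall a b, D (F a) (F b) <= \sum_i mdist (a i) (b i).
Proof.
move=> Dxx Dtri FD a b.
(* Telescoping along hybrids of [a] and [b]: passing from [h m] to [h m.+1] changes only coordinate
   [m], and nothing at all once [m >= n]. *)
pose h m : 'I_n -> Y := fun i => if (i < m)%N then b i else a i.
suff H m : D (F a) (F (h m)) <= \sum_(i < n | (i < m)%N) mdist (a i) (b i).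
  have -> : b = h n by apply/funext => i; rewrite /h ltn_ord.
  by apply: le_trans (H n) _; rewrite le_eqVlt; apply/orP; left; apply/eqP;
    apply: eq_big => i; rewrite ?ltn_ord// /h ltn_ord.
elim: m => [|m IH].
  by rewrite big_pred0// (_ : h 0%N = a) ?Dxx//; apply/funext.
have [mn|nm] := ltnP m n; last first.
  suff hm : h m.+1 = h m.
    rewrite hm; apply: le_trans IH _.
    rewrite [leRHS](eq_bigl (fun i : 'I_n => (i < m)%N))// => i.
    by rewrite !(leq_trans (ltn_ord i))// ltnW.
  by apply/funext => i; rewrite /h !(leq_trans (ltn_ord i))// ltnW.
apply: le_trans (Dtri _ (F (h m)) _) _.
rewrite [leRHS](bigD1 (Ordinal mn))//= [leLHS]addrC; apply: lerD.
  have hm j : j != Ordinal mn -> h m j = h m.+1 j.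
    rewrite /h -val_eqE /= ltnS [(j <= m)%N]leq_eqVlt => /negPf ->.
    by [].
  apply: le_trans (FD _ _ _ hm) _.
  by rewrite /h /= ltnn ltnSn.
apply: le_trans IH _; rewrite le_eqVlt; apply/orP; left; apply/eqP.
apply: eq_bigl => j; rewrite -val_eqE /= ltnS [(j <= m)%N]leq_eqVlt.
by case: ltngtP.
Qed.

Lemma ipred_lipschitz (R : realType) (Y : metricType R) (L : signature)
    (M : structure Y L) (P : psym L) (a b : 'I_(parity P) -> Y) :
  `|ipred M a - ipred M b| <= \sum_i mdist (a i) (b i).
Proof.
apply: (coordinatewise_lipschitz (D := fun x y : R => `|x - y|)).
- by move=> x; rewrite subrr normr0.
- by move=> x y z; exact: ler_distD.
- exact: ipred_lip.
Qed.

Lemma ifun_lipschitz (R : realType) (Y : metricType R) (L : signature)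
    (M : structure Y L) (f : Defs.fsym L) (a b : 'I_(farity f) -> Y) :
  mdist (ifun M a) (ifun M b) <= \sum_i mdist (a i) (b i).
Proof.
apply: (coordinatewise_lipschitz (D := mdist)).
- exact: mdistxx.
- exact: metric_triangle.
- exact: ifun_lip.
Qed.

Lemma mdist_quadrangle (R : realType) (Y : metricType R) (x y x' y' : Y) :
  `|mdist x y - mdist x' y'| <= mdist x x' + mdist y y'.
Proof.
have H (u v u' v' : Y) : mdist u v - mdist u' v' <= mdist u u' + mdist v v'.
  have := metric_triangle u u' v; have := metric_triangle u' v' v.
  by rewrite (metric_sym v' v); lra.
rewrite ler_norml H andbT; have := H x' y' x y.
by rewrite (metric_sym x' x) (metric_sym y' y); lra.
Qed.

(** A variable has constant 1, and by [ifun_lipschitz] the constants of the arguments of a function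
    symbol add up. The bound [e] encodes the maximum distance on tuples. *)
Lemma teval_lipschitz (R : realType) (Y : metricType R) (L : signature)
    (M : structure Y L) (n : nat) (t : term L n) :
  exists2 K : R, 0 <= K & forall a b e, 0 <= e ->
    (forall i, mdist (a i) (b i) <= e) ->
    mdist (teval M t a) (teval M t b) <= K * e.
Proof.
elim: t => [i|f u IH] /=; first by exists 1 => // a b e _ /(_ i); rewrite mul1r.
have /choice[K HK] j : exists K : R, 0 <= K /\
    forall a b e, 0 <= e -> (forall i, mdist (a i) (b i) <= e) ->
    mdist (teval M (u j) a) (teval M (u j) b) <= K * e.
  by have [K] := IH j; exists K.
exists (\sum_j K j); first by apply: sumr_ge0 => j _; case: (HK j).
move=> a b e e0 abe; apply: le_trans (ifun_lipschitz _ _ _) _.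
by rewrite mulr_suml; apply: ler_sum => j _; apply: (HK j).2.
Qed.

(** * Suprema of real-valued functions *)

Section sup_range.
Variables (R : realType) (Y : Type).
Implicit Types f g : Y -> R.

(** Lets the [FInf] cases below be treated through suprema. *)
Lemma inf_range f : inf (range f) = - sup (range (fun y => - f y)).
Proof.
rewrite /inf; congr (- sup _).
by apply/seteqP; split=> [_ [_ [y _ <-] <-]|_ [y _ <-]];
  [exists y|exists (f y) => //; exists y].
Qed.

(** The interval has to contain 0 because [Y] may be empty, and [sup set0] is 0. *)
Lemma sup_range_bounds (c d : R) f : c <= 0 <= d -> (forall y, c <= f y <= d) ->
  c <= sup (range f) <= d.
Proof.
move=> cd fcd; have [->|/set0P R0] := eqVneq (range f) set0; first by rewrite sup0.
have ub : ubound (range f) d by move=> _ [y _ <-]; case/andP: (fcd y).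
rewrite ge_sup// andbT; case: R0 => _ [y _ _].
apply: (@le_trans _ _ (f y)); first by case/andP: (fcd y).
by apply: ub_le_sup; [exists d|exists y].
Qed.

(** The common upper bound [c] makes both suprema genuine least upper bounds when [Y] is inhabited;
    for empty [Y] both are the default value 0. *)
Lemma sup_range_dist (c e : R) f g : 0 <= e ->
  (forall y, f y <= c) -> (forall y, g y <= c) ->
  (forall y, `|f y - g y| <= e) ->
  `|sup (range f) - sup (range g)| <= e.
Proof.
move=> e0 fc gc fge.
have [Y0|Y0] := pselect (inhabited Y); last first.
  have r0 (h : Y -> R) : range h = set0.
    by apply/seteqP; split=> // x [y _ _]; case: Y0; exact: inhabits y.
  by rewrite !r0 subrr normr0.
have H (h k : Y -> R) : (forall y, k y <= c) -> (forall y, `|h y - k y| <= e) ->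
    sup (range h) <= sup (range k) + e.
  move=> kc hke; case: Y0 => y0; apply: ge_sup; first by exists (h y0), y0.
  move=> _ [y _ <-]; have : k y <= sup (range k).
    by apply: ub_le_sup; [exists c => _ [z _ <-]|exists y].
  by have := hke y; rewrite ler_norml; lra.
have := H f g gc fge; have := H g f fc (fun y => _).
have gfe y : `|g y - f y| <= e by rewrite distrC.
by move=> /(_ gfe); rewrite ler_norml; lra.
Qed.

End sup_range.

(** * Bounds and Lipschitz constants of formulas *)

Section feval_bounds.
Context {R : realType} {Y : metricType R} {L : signature}.
Hypothesis d_le1 : forall x y : Y, mdist x y <= 1.
Variable M : structure Y L.

Lemma feval01 (n : nat) (p : formula L n) (a : 'I_n -> Y) :
  0 <= feval M p a <= 1.
Proof.
elim: p a => {n} /=.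
- by move=> n a; lra.
- by move=> n a; lra.
- by move=> n P u a; exact: ipred01.
- by move=> n t u a; rewrite mdist_ge0 d_le1.
- by move=> n p IH a; have := IH a; lra.
- move=> n p IHp q IHq a; have := IHp a; have := IHq a.
  by rewrite le_max ge_max lexx orbT; lra.
- move=> n p IHp q IHq a; have := IHp a; have := IHq a.
  by move=> /andP[q0 q1] /andP[p0 p1]; rewrite le_min ge_min p0 q0 p1.
- move=> n p IHp q IHq a; have := IHp a; have := IHq a.
  by move=> /andP[q0 q1] /andP[p0 p1]; rewrite le_max ge_max p0 q1 p1.
- move=> n p IHp q IHq a; have := IHp a; have := IHq a.
  by rewrite normr_ge0 ler_norml; lra.
- by move=> n p IH a; have := IH a; lra.
- move=> n p IHp q IHq a; have := IHp a; have := IHq a.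
  by move=> /andP[q0 q1] /andP[p0 p1]; rewrite le_min ge_min lexx orbT addr_ge0 ?ler01.
- move=> n r r0 p IH a; have /andP[p0 p1] := IH a.
  by rewrite le_min ge_min lexx orbT mulr_ge0 ?ler01// ler0q ltW.
- by move=> n p IH a; apply: sup_range_bounds => //; lra.
- move=> n p IH a; rewrite inf_range.
  suff : -1 <= sup (range (fun y => - feval M p (trcons a y))) <= 0 by lra.
  apply: sup_range_bounds; first by lra.
  by move=> y; have := IH (trcons a y); lra.
Qed.

(** Constants add up over the terms of an atomic formula and over the two sides of a binary
    connective; scaling multiplies them, and the other connectives and the quantifiers keep them.
    The bounds of [feval01] are what makes the quantifier cases work. *)
Lemma feval_lipschitz (n : nat) (p : formula L n) :
  exists2 K : R, 0 <= K & forall a b e, 0 <= e ->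
    (forall i, mdist (a i) (b i) <= e) ->
    `|feval M p a - feval M p b| <= K * e.
Proof.
(* Appending the same last entry to both tuples does not increase their maximum distance. *)
have tri m (a b : 'I_m -> Y) e y : 0 <= e -> (forall i, mdist (a i) (b i) <= e) ->
    forall i, mdist (trcons a y i) (trcons b y i) <= e.
  by move=> e0 ab i; rewrite /trcons; case: unlift => [j|]//; rewrite mdistxx.
elim: p => {n} /=.
- by move=> n; exists 0 => // a b e e0 _; rewrite subrr normr0 mul0r.
- by move=> n; exists 0 => // a b e e0 _; rewrite subrr normr0 mul0r.
- move=> n P u.
  have /choice[K HK] j : exists K : R, 0 <= K /\
      forall a b e, 0 <= e -> (forall i, mdist (a i) (b i) <= e) ->
      mdist (teval M (u j) a) (teval M (u j) b) <= K * e.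
    by have [K] := teval_lipschitz M (u j); exists K.
  exists (\sum_j K j); first by apply: sumr_ge0 => j _; case: (HK j).
  move=> a b e e0 abe; apply: le_trans (ipred_lipschitz _ _ _) _.
  by rewrite mulr_suml; apply: ler_sum => j _; apply: (HK j).2.
- move=> n t u.
  have [K K0 HK] := teval_lipschitz M t; have [H H0 HH] := teval_lipschitz M u.
  exists (K + H); first exact: addr_ge0.
  move=> a b e e0 abe; apply: le_trans (mdist_quadrangle _ _ _ _) _.
  by rewrite mulrDl lerD// ?HK ?HH.
- move=> n p [K K0 HK]; exists K => // a b e e0 abe.
  have := HK a b e e0 abe; have : 0 <= K * e by exact: mulr_ge0.
  by rewrite !ler_norml; lra.
(* All binary connectives are opened at once, with the constant [K + H]. *)
all: try (move=> n p [K K0 HK] q [H H0 HH]; exists (K + H); first exact: addr_ge0;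
  move=> a b e e0 abe; have := HK a b e e0 abe; have := HH a b e e0 abe;
  rewrite !ler_norml mulrDl).
- by rewrite /Num.max; do 2 case: ifPn; rewrite -?leNgt; lra.
- by rewrite /Num.min; do 2 case: ifPn; rewrite -?leNgt; lra.
- by rewrite /Num.max; do 2 case: ifPn; rewrite -?leNgt; lra.
- set x := feval M p a - feval M q a; set y := feval M p b - feval M q b.
  move=> h1 h2; have xy : `|x - y| <= K * e + H * e.
    by rewrite ler_norml /x /y; lra.
  by have := ler_dist_dist x y; rewrite ler_norml; lra.
- move=> n p [K K0 HK]; exists K => // a b e e0 abe.
  by have := HK a b e e0 abe; rewrite !ler_norml; lra.
- by rewrite /Num.min; do 2 case: ifPn; rewrite -?leNgt; lra.
- move=> n r r0 p [K K0 HK].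
  have r0' : 0 < ratr r :> R by rewrite ltr0q.
  exists (ratr r * K); first by rewrite mulr_ge0// ltW.
  move=> a b e e0 abe.
  have : `|ratr r * feval M p a - ratr r * feval M p b| <= ratr r * K * e.
    by rewrite -mulrBr normrM gtr0_norm// -mulrA ler_pM2l// HK.
  have : 0 <= ratr r * K * e by apply: mulr_ge0 => //; rewrite mulr_ge0// ltW.
  move: (ratr r * K * e) (ratr r * feval M p a) (ratr r * feval M p b) => z x y.
  rewrite !ler_norml.
  by rewrite /Num.min; do 2 case: ifPn; rewrite -?leNgt; lra.
- move=> n p [K K0 HK]; exists K => // a b e e0 abe.
  apply: (@sup_range_dist _ _ 1); first exact: mulr_ge0.
  + by move=> y; case/andP: (feval01 p (trcons a y)).
  + by move=> y; case/andP: (feval01 p (trcons b y)).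
  + by move=> y; apply: HK => //; exact: tri.
- move=> n p [K K0 HK]; exists K => // a b e e0 abe.
  rewrite !inf_range -opprD normrN.
  apply: (@sup_range_dist _ _ 0); first exact: mulr_ge0.
  + by move=> y; have := feval01 p (trcons a y); lra.
  + by move=> y; have := feval01 p (trcons b y); lra.
  + by move=> y; rewrite -opprD normrN; apply: HK => //; exact: tri.
Qed.

End feval_bounds.

(** * Countable operations on Borel sets *)

Section borel_sets.
Context {T : topologicalType}.
Implicit Types (A B : set T) (P Q : T -> Prop).

Lemma open_borel A : open A -> borel A.
Proof. exact: sub_sigma_algebra. Qed.

Lemma borelC A : borel A -> borel (~` A).
Proof. by move=> bA; rewrite -setTD; exact: sigma_algebraCD. Qed.

Lemma borel_cst (C : Prop) : borel [set x : T | C].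
Proof.
have [c|nc] := pselect C.
  by rewrite (_ : mkset _ = setT); [apply: open_borel; exact: openT|
    apply/seteqP; split].
by rewrite (_ : mkset _ = set0); [apply: open_borel; exact: open0|
  apply/seteqP; split].
Qed.

(** The union is reindexed by the values of an injection from [D] to [nat]: each slice is the set of
    a single [P i], or empty. *)
Lemma borel_exists_in (I : Type) (D : set I) (P : I -> T -> Prop) :
  countable D -> (forall i, D i -> borel [set x | P i x]) ->
  borel [set x | exists i, D i /\ P i x].
Proof.
move=> /countable_injP[f finj] bP.
rewrite (_ : mkset _ = \bigcup_n [set x | exists i, [/\ D i, f i = n & P i x]]).
  apply: sigma_algebra_bigcup => n.
  have [[i [Di fi]]|nex] := pselect (exists i, D i /\ f i = n).
    rewrite (_ : mkset _ = [set x | P i x]); first exact: bP.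
    apply/seteqP; split=> [x [j [Dj fj Pj]]|x Px]; last by exists i.
    by rewrite (finj i j) ?inE// fi fj.
  rewrite (_ : mkset _ = set0); first exact: sigma_algebra0.
  by apply/seteqP; split=> // x [i [Di fi _]]; apply: nex; exists i.
apply/seteqP; split=> [x [i [Di Pi]]|x [n _ [i [Di _ Pi]]]]; last by exists i.
by exists (f i) => //; exists i.
Qed.

Lemma borel_exists (I : countType) (P : I -> T -> Prop) :
  (forall i, borel [set x | P i x]) -> borel [set x | exists i, P i x].
Proof.
move=> bP; rewrite (_ : mkset _ = [set x | exists i, [set: I] i /\ P i x]).
  by apply: borel_exists_in => //; exact: countableP.
by apply/seteqP; split=> x [i]; [exists i|move=> [_]; exists i].
Qed.

Lemma borel_not P : borel [set x | P x] -> borel [set x | ~ P x].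
Proof. exact: borelC. Qed.

Lemma borel_forall_in (I : Type) (D : set I) (P : I -> T -> Prop) :
  countable D -> (forall i, D i -> borel [set x | P i x]) ->
  borel [set x | forall i, D i -> P i x].
Proof.
move=> cD bP.
rewrite (_ : mkset _ = [set x | ~ exists i, D i /\ ~ P i x]).
  by apply: borel_not; apply: borel_exists_in => // i Di; apply: borel_not (bP i Di).
apply/seteqP; split=> x; first by move=> Px [i [Di]]; apply; exact: Px.
by move=> nex i Di; apply: contrapT => nP; apply: nex; exists i.
Qed.

Lemma borel_forall (I : countType) (P : I -> T -> Prop) :
  (forall i, borel [set x | P i x]) -> borel [set x | forall i, P i x].
Proof.
move=> bP; rewrite (_ : mkset _ = [set x | forall i, [set: I] i -> P i x]).
  by apply: borel_forall_in => //; exact: countableP.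
by apply/seteqP; split=> x Px i; [move=> _|]; apply: Px.
Qed.

Lemma borel_and P Q : borel [set x | P x] -> borel [set x | Q x] ->
  borel [set x | P x /\ Q x].
Proof.
move=> bP bQ.
rewrite (_ : mkset _ = [set x | forall b : bool, if b then P x else Q x]).
  by apply: borel_forall => -[].
apply/seteqP; split=> x; first by move=> [Px Qx] [].
by move=> PQ; split; [exact: (PQ true)|exact: (PQ false)].
Qed.

Lemma borel_imply P Q : borel [set x | P x] -> borel [set x | Q x] ->
  borel [set x | P x -> Q x].
Proof.
move=> bP bQ; rewrite (_ : mkset _ = [set x | ~ (P x /\ ~ Q x)]).
  by apply: borel_not; apply: borel_and => //; exact: borel_not.
apply/seteqP; split=> x; first by move=> PQ [Px]; apply; exact: PQ.
by move=> nPQ Px; apply: contrapT => nQ; apply: nPQ.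
Qed.

End borel_sets.

(** * Real-valued Borel functions *)

Lemma sigma_algebra_borel_preimage (T : topologicalType) (U : Type)
  (f : T -> U) : sigma_algebra setT [set B | borel (f @^-1` B)].
Proof.
split=> /=.
- by rewrite preimage_set0; exact: sigma_algebra0.
- by move=> A bA; rewrite setTD preimage_setC; exact: borelC.
- by move=> A bA; rewrite preimage_bigcup; exact: sigma_algebra_bigcup.
Qed.

(** [T] carries only a topology, so preimages are tested against [borel] rather than against a
    measurable structure on [T]. *)
Definition borel_fun (T : topologicalType) (R : realType) (f : T -> R) : Prop :=
  forall B : set R, measurable B -> borel (f @^-1` B).

Section borel_functions.
Context {T : topologicalType} {R : realType}.
Implicit Types f g : T -> R.

Lemma borel_fun_gt f : (forall r, borel [set x | r < f x]) -> borel_fun f.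
Proof.
have RE : measurable = <<s @RGenOInfty.G R >> :> set (set R).
  exact: RGenOInfty.measurableE.
move=> bf B; rewrite RE; move: B.
apply: (@smallest_sub _ _ _ [set B | borel (f @^-1` B)]).
  exact: sigma_algebra_borel_preimage.
by move=> _ [r ->] /=; rewrite preimage_itvoy.
Qed.

(** Continuity in this form makes each set [r < f x] open, with margin [f x - r]. It serves for the
    atomic formulas. *)
Lemma borel_fun_near f :
  (forall x e, 0 < e -> \forall y \near x, `|f x - f y| < e) -> borel_fun f.
Proof.
move=> fnear; apply: borel_fun_gt => r; apply: open_borel.
rewrite openE => x /= rfx; rewrite /interior.
have : 0 < f x - r by rewrite subr_gt0.
move=> /(fnear x); apply: filterS => y /=; rewrite ltr_norml; lra.
Qed.

Lemma borel_fun_cst (r : R) : borel_fun (fun _ : T => r).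
Proof. by move=> B _; exact: (borel_cst (B r)). Qed.

Lemma borel_fun_comp f (h : R -> R) :
  measurable_fun setT h -> borel_fun f -> borel_fun (fun x => h (f x)).
Proof.
move=> mh bf B mB; have := bf (h @^-1` B); apply.
by rewrite -[_ @^-1` _]setTI; exact: mh.
Qed.

(** Measurable rectangles generate the product sigma-algebra, and the preimage of a rectangle is an
    intersection of two Borel sets. This handles the binary connectives. *)
Lemma borel_fun_comp2 f g (h : R * R -> R) :
  measurable_fun setT h -> borel_fun f -> borel_fun g ->
  borel_fun (fun x => h (f x, g x)).
Proof.
move=> mh bf bg B mB.
suff H : forall C : set (R * R), measurable C ->
    borel ((fun x => (f x, g x)) @^-1` C).
  by apply: (H (h @^-1` B)); rewrite -[_ @^-1` _]setTI; exact: mh.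
rewrite measurable_prod_measurableType.
apply: (@smallest_sub _ _ _ [set B | borel ((fun x => (f x, g x)) @^-1` B)]).
  exact: (sigma_algebra_borel_preimage (fun x => (f x, g x))).
move=> _ [A mA [C mC <-]] /=.
by apply: (borel_and (P := fun x => A (f x)) (Q := fun x => C (g x)));
  [exact: bf|exact: bg].
Qed.

Lemma borel_fun_le f (r : R) : borel_fun f -> borel [set x | f x <= r].
Proof.
move=> bf; have := bf `]-oo, r]%classic (measurable_itv _).
by rewrite preimage_itvNyc.
Qed.

Lemma borel_fun_eq f (r : R) : borel_fun f -> borel [set x | f x = r].
Proof. by move=> bf; exact: (bf [set r] (measurable_set1 r)). Qed.

End borel_functions.

(** * Suprema over a dense set and continuity in a parameter *)

Lemma dense_mdist (R : realType) (Y : metricType R) (S : set Y) (y : Y) (e : R) :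
  dense S -> 0 < e -> exists2 s, S s & mdist y s < e.
Proof.
move=> dS e0; have [||s [ys Ss]] := dS (ball y e)^°.
- by exists y; exact: nbhsx_ballx.
- exact: open_interior.
- by exists s => //; have := interior_subset ys; rewrite ballEmdist.
Qed.

(** By the Lipschitz bound, a value above [r] persists at a nearby point of [S], so the supremum
    exceeds [r] exactly when some value on the countable set [S] does. The constant [K] may depend
    on [x]. *)
Lemma borel_fun_sup (R : realType) (Y : metricType R) (S : set Y)
    (T : topologicalType) (f : T -> Y -> R) (c : R) :
  countable S -> dense S -> (forall x y, f x y <= c) ->
  (forall x, exists2 K : R, 0 <= K &
    forall y z, `|f x y - f x z| <= K * mdist y z) ->
  (forall y, borel_fun (f^~ y)) -> borel_fun (fun x => sup (range (f x))).
Proof.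
move=> cS dS fc flip bf.
have [[y0]|nY] := pselect (inhabited Y); last first.
  rewrite (_ : (fun x => _) = fun=> 0); first exact: borel_fun_cst.
  apply/funext => x; rewrite (_ : range _ = set0) ?sup0//.
  by apply/seteqP; split=> // z [y _ _]; case: nY; exact: inhabits y.
apply: borel_fun_gt => r.
rewrite (_ : mkset _ = [set x | exists s, S s /\ r < f x s]).
  apply: borel_exists_in => // s _.
  have := bf s `]r, +oo[%classic (measurable_itv _).
  by rewrite preimage_itvoy.
apply/seteqP; split=> x /=.
  have R0 : range (f x) !=set0 by exists (f x y0), y0.
  move=> /(sup_gt R0)[_ [y _ <-] ry]; have [K K0 HK] := flip x.
  have K1 : 0 < K + 1 by rewrite ltr_wpDl.
  (* Moving [y] by less than this radius changes [f x] by less than [f x y - r]; [K + 1] keeps the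
     denominator positive. *)
  have [||s Ss ys] := @dense_mdist _ _ S y ((f x y - r) / (K + 1)) => //.
    by rewrite divr_gt0 ?subr_gt0// ltr_wpDl.
  exists s; split=> //; have := HK y s.
  move: ys; rewrite ltr_pdivlMr// => ys.
  by have := mdist_ge0 y s; rewrite ler_norml; nra.
move=> [s [Ss rs]]; apply: lt_le_trans rs _.
by apply: ub_le_sup; [exists c => _ [y _ <-]|exists s].
Qed.

(** [F x] stands for the interpretation of a symbol in the structure [x], and [u x] for the values
    of its arguments: function and point move together. The Lipschitz bound, uniform in [x], carries
    continuity from tuples of [S] to arbitrary ones. *)
Lemma near_coordinatewise (R : realType) (Y : metricType R) (S : set Y)
    (T : topologicalType) (Z : Type) (D : Z -> Z -> R) (n : nat)
    (F : T -> ('I_n -> Y) -> Z) (u : T -> 'I_n -> Y) :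
  dense S -> (forall x y z, D x z <= D x y + D y z) ->
  (forall x a b, D (F x a) (F x b) <= \sum_i mdist (a i) (b i)) ->
  (forall s, tuples_of S n s ->
    forall x e, 0 < e -> \forall y \near x, D (F x s) (F y s) < e) ->
  (forall i x e, 0 < e -> \forall y \near x, mdist (u x i) (u y i) < e) ->
  forall x e, 0 < e -> \forall y \near x, D (F x (u x)) (F y (u y)) < e.
Proof.
move=> dS Dtri FD Fnear unear x e e0.
(* The path from [F x (u x)] through [F x s] and [F y s] to [F y (u y)] costs at most [e / 4], less
   than [e / 4], and at most [2 * (e / 4)]. Using [n.+1] avoids dividing by zero when [n] is 0. *)
pose d := e / 4 / n.+1%:R; have d0 : 0 < d by rewrite !divr_gt0.
have nd : d * n%:R <= e / 4.
  by rewrite /d -mulrA ler_piMr ?divr_ge0 ?ltW// mulrC ltr_pdivrMr// mul1r ltr_nat.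
(* Approximating [u x] by a tuple [s] from [S], only the values at [s] have to be
   compared for different [x]. *)
have /choice[s Hs] i : exists s, S s /\ mdist (u x i) s < d.
  by have [s] := dense_mdist (u x i) dS d0; exists s.
have Ss : tuples_of S n s by move=> i; case: (Hs i).
have e40 : 0 < e / 4 by rewrite divr_gt0.
have near_u : \forall y \near x, forall i, mdist (u x i) (u y i) < d.
  by apply: filter_forall => i; exact: unear.
apply: filterS2 (Fnear s Ss x _ e40) near_u => y Fy uy.
have sumd (a b : 'I_n -> Y) (k : R) : (forall i, mdist (a i) (b i) <= k * d) ->
    0 <= k -> D (F y a) (F y b) <= k * (e / 4) /\
    D (F x a) (F x b) <= k * (e / 4).
  move=> abd k0.
  suff H : \sum_i mdist (a i) (b i) <= k * (e / 4).
    by split; apply: le_trans (FD _ _ _) H.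
  apply: (@le_trans _ _ (\sum_(i < n) k * d)); first exact: ler_sum.
  by rewrite sumr_const card_ord -[_ *+ n]mulr_natr -mulrA ler_wpM2l.
have us i : mdist (u x i) (s i) <= 1 * d by rewrite mul1r ltW//; case: (Hs i).
have su i : mdist (s i) (u y i) <= 2 * d.
  apply: le_trans (metric_triangle _ (u x i) _) _; rewrite metric_sym.
  by have [_] := Hs i; have := uy i; lra.
have [_ xus] := sumd (u x) s 1 us ler01.
have [ysu _] := sumd s (u y) 2 su (ler0n _ _).
have := Dtri (F x (u x)) (F x s) (F y (u y)).
by have := Dtri (F x s) (F y s) (F y (u y)); lra.
Qed.

(** * Borel measurability in the space of structures *)

Section structure_space_borel.
Context {R : realType} {Y : metricType R}.
Variables (L : signature) (S : set Y).
Hypothesis S_dense : dense S.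
Local Notation YL := (structure_space L S).

Lemma near_ipred_sample (P : psym L) (s : 'I_(parity P) -> Y) :
  tuples_of S (parity P) s -> forall (M : YL) (e : R), 0 < e ->
  \forall N \near M, `|ipred (M : structure Y L) s - ipred N s| < e.
Proof.
move=> Ss M e e0.
have Ss' : s \in tuples_of S (parity P) by exact: mem_set.
(* The supremum topology refines the initial topology of the sample given by [P] and [s]. *)
have /cvg_sup/(_ (inl (existT _ P (SigSub Ss')))) MM : nbhs M --> M by [].
apply: MM => /=.
have := @initial_continuous (structure Y L) R (fun M => ipred M s) M.
by move=> /cvgrPdist_lt/(_ e e0).
Qed.

Lemma near_ifun_sample (f : Defs.fsym L) (s : 'I_(farity f) -> Y) :
  tuples_of S (farity f) s -> forall (M : YL) (e : R), 0 < e ->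
  \forall N \near M, mdist (ifun (M : structure Y L) s) (ifun N s) < e.
Proof.
move=> Ss M e e0.
have Ss' : s \in tuples_of S (farity f) by exact: mem_set.
have /cvg_sup/(_ (inr (existT _ f (SigSub Ss')))) MM : nbhs M --> M by [].
apply: MM => /=.
have := @initial_continuous (structure Y L) Y (fun M => ifun M s) M.
by move=> /metricType_numDomainType.cvgrPdist_lt/(_ e e0).
Qed.

(** Values of subterms may leave [S] even when [a] comes from [S], so the induction needs
    [near_coordinatewise] at arbitrary points of [Y]. *)
Lemma near_teval (n : nat) (t : term L n) (a : 'I_n -> Y) (M : YL) (e : R) :
  0 < e -> \forall N \near M, mdist (teval M t a) (teval N t a) < e.
Proof.
elim: t M e => [i|f u IH] M e e0 /=.
  by apply: (@filterE _ (nbhs M)) => N; rewrite mdistxx.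
apply: (@near_coordinatewise _ _ _ YL _ mdist _
  (fun N => @ifun _ _ _ (N : structure Y L) f)
  (fun N j => teval (N : structure Y L) (u j) a) S_dense _ _ _ _ M e e0) => //.
- exact: metric_triangle.
- by move=> N b c; exact: ifun_lipschitz.
- exact: near_ifun_sample.
Qed.

Lemma near_ipred_teval (n : nat) (P : psym L) (u : 'I_(parity P) -> term L n)
    (a : 'I_n -> Y) (M : YL) (e : R) : 0 < e ->
  \forall N \near M, `|feval M (FPred u) a - feval N (FPred u) a| < e.
Proof.
move=> e0; apply: (@near_coordinatewise _ _ _ YL _ (fun x y : R => `|x - y|) _
  (fun N => @ipred _ _ _ (N : structure Y L) P)
  (fun N j => teval (N : structure Y L) (u j) a) S_dense _ _ _ _ M e e0).
- by move=> x y z; exact: ler_distD.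
- by move=> N b c; exact: ipred_lipschitz.
- exact: near_ipred_sample.
- by move=> j N d; exact: near_teval.
Qed.

Lemma near_dist_teval (n : nat) (t u : term L n) (a : 'I_n -> Y) (M : YL)
    (e : R) : 0 < e ->
  \forall N \near M, `|feval M (FDist t u) a - feval N (FDist t u) a| < e.
Proof.
move=> e0; have e20 : 0 < e / 2 by rewrite divr_gt0.
apply: filterS2 (near_teval t a M e20) (near_teval u a M e20) => N tN uN /=.
by apply: le_lt_trans (mdist_quadrangle _ _ _ _) _; lra.
Qed.

Hypothesis d_le1 : forall x y : Y, mdist x y <= 1.
Hypothesis S_countable : countable S.

(** Atomic values are continuous in [M], connectives are measurable functions of one or two reals,
    and quantifiers fall under [borel_fun_sup]. *)
Lemma borel_feval (n : nat) (p : formula L n) (a : 'I_n -> Y) :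
  borel_fun (fun M : YL => feval M p a).
Proof.
have trlip m (q : formula L m.+1) (b : 'I_m -> Y) (M : YL) :
    exists2 K : R, 0 <= K & forall y z,
    `|feval M q (trcons b y) - feval M q (trcons b z)| <= K * mdist y z.
  have [K K0 HK] := feval_lipschitz d_le1 M q; exists K => // y z.
  apply: HK => [|i]; first exact: mdist_ge0.
  by rewrite /trcons; case: unlift => [j|//]; rewrite mdistxx mdist_ge0.
elim: p a => {n} /=.
- by move=> n a; exact: borel_fun_cst.
- by move=> n a; exact: borel_fun_cst.
- by move=> n P u a; apply: borel_fun_near => M e; exact: near_ipred_teval.
- by move=> n t u a; apply: borel_fun_near => M e; exact: near_dist_teval.
- move=> n p IH a; apply: (borel_fun_comp (h := fun x => x / 2)) => //.
  exact: measurable_funM.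
- move=> n p IHp q IHq a.
  apply: (borel_fun_comp2 (h := fun x => Num.max (x.1 - x.2) 0)) => //.
  by apply: measurable_maxr => //; exact: measurable_funB.
- move=> n p IHp q IHq a.
  apply: (borel_fun_comp2 (h := fun x => Num.min x.1 x.2)) => //.
  exact: measurable_minr.
- move=> n p IHp q IHq a.
  apply: (borel_fun_comp2 (h := fun x => Num.max x.1 x.2)) => //.
  exact: measurable_maxr.
- move=> n p IHp q IHq a.
  apply: (borel_fun_comp2 (h := fun x => `|x.1 - x.2|)) => //.
  by apply: measurableT_comp => //; exact: measurable_funB.
- move=> n p IH a; apply: (borel_fun_comp (h := fun x => 1 - x)) => //.
  exact: measurable_funB.
- move=> n p IHp q IHq a.
  apply: (borel_fun_comp2 (h := fun x => Num.min (x.1 + x.2) 1)) => //.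
  by apply: measurable_minr => //; exact: measurable_funD.
- move=> n r r0 p IH a.
  apply: (borel_fun_comp (h := fun x => Num.min (ratr r * x) 1)) => //.
  by apply: measurable_minr => //; exact: measurable_funM.
- move=> n p IH a.
  apply: (borel_fun_sup (c := 1) S_countable S_dense) => // M y.
  by case/andP: (feval01 d_le1 M p (trcons a y)).
- move=> n p IH a.
  rewrite (_ : (fun M => _) = fun M : YL =>
    - sup (range (fun y => - feval M p (trcons a y)))); last first.
    by apply/funext => M; rewrite inf_range.
  apply: borel_fun_comp; first exact: oppr_measurable.
  apply: (borel_fun_sup (c := 0) S_countable S_dense).
  + by move=> M y; rewrite oppr_le0; case/andP: (feval01 d_le1 M p (trcons a y)).
  + move=> M; have [K K0 HK] := trlip _ p a M; exists K => // y z.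
    by rewrite -opprD normrN.
  + by move=> y; apply: borel_fun_comp; [exact: oppr_measurable|exact: IH].
Qed.

Lemma borel_SC : borel (SC L S).
Proof.
(* [Q] is the defining condition of [SC] for fixed witnesses, to be shown Borel before the union
   over all witnesses is taken. *)
pose Q n (eps : rat) k (a_ : 'I_k -> 'I_n -> Y) (phi : 'I_k -> formula L n)
    (delta : 'I_k -> rat) (M : YL) :=
  [/\ forall i, tuples_of S n (a_ i) /\ feval M (phi i) (a_ i) <= ratr (delta i),
      forall a, tuples_of S n a ->
        exists i, feval M (phi i) a <= ratr (delta i)
    & forall i a c,
        tuples_of S n a -> feval M (phi i) a <= ratr (delta i) ->
        tuples_of S n.+1 c -> feval M (phi i) (tinit c) <= ratr (delta i) ->
        forall Delta : set (formula L n.+1), finite_set Delta ->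
        (forall psi, Delta psi -> feval M psi c = 0) ->
        exists b, [/\ tuples_of S n.+1 b,
          forall j, mdist (a j) (tinit b j) <= ratr eps
          & forall psi, Delta psi -> feval M psi b = 0]].
have bQ n eps k a_ phi delta : borel [set M | @Q n eps k a_ phi delta M].
  have cS m := countable_tuples_of m S_countable.
  have cD m (Delta : set (formula L m)) : countable Delta.
    by apply: sub_countable (countable_formula L m); exact: subset_card_le.
  have bD m (Delta : set (formula L m)) c :
      borel [set M : YL | forall psi, Delta psi -> feval M psi c = 0].
    by apply: borel_forall_in => // psi _; exact: borel_fun_eq (borel_feval _ _).
  (* Nested binary conjunctions fit [borel_and], and the finite sets [Delta] are gathered in one
     set, countable because there are countably many formulas. *)
  rewrite (_ : mkset _ = [set M : YL |
    (forall i, tuples_of S n (a_ i) /\ feval M (phi i) (a_ i) <= ratr (delta i))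
    /\ (forall a, tuples_of S n a ->
        exists i, feval M (phi i) a <= ratr (delta i))
    /\ forall i a, tuples_of S n a -> feval M (phi i) a <= ratr (delta i) ->
        forall c, tuples_of S n.+1 c ->
        feval M (phi i) (tinit c) <= ratr (delta i) ->
        forall Delta : set (formula L n.+1),
        [set D | D `<=` setT /\ finite_set D] Delta ->
        (forall psi, Delta psi -> feval M psi c = 0) ->
        exists b, tuples_of S n.+1 b /\
          ((forall j, mdist (a j) (tinit b j) <= ratr eps)
          /\ forall psi, Delta psi -> feval M psi b = 0)]).
    apply: borel_and.
      apply: borel_forall => i; apply: borel_and; first exact: borel_cst.
      exact: borel_fun_le (borel_feval _ _).
    apply: borel_and.
      apply: borel_forall_in => // a _; apply: borel_exists => i.
      exact: borel_fun_le (borel_feval _ _).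
    apply: borel_forall => i; apply: borel_forall_in => // a _.
    apply: borel_imply; first exact: borel_fun_le (borel_feval _ _).
    apply: borel_forall_in => // c _.
    apply: borel_imply; first exact: borel_fun_le (borel_feval _ _).
    apply: borel_forall_in.
      apply: countable_finite_subset; exact: countable_formula.
    move=> Delta _; apply: borel_imply; first exact: bD.
    apply: borel_exists_in => // b _.
    by apply: borel_and; [exact: borel_cst|exact: bD].
  apply/seteqP; split=> M.
    move=> [H1 H2 H3]; split=> //; split=> // i a Sa Ha c Sc Hc Delta [_ fD] HD.
    by have [b [Sb ab HDb]] := H3 i a c Sa Ha Sc Hc Delta fD HD; exists b.
  move=> [H1 [H2 H3]]; split=> // i a c Sa Ha Sc Hc Delta fD HD.
  have [|b [Sb [ab HDb]]] := H3 i a Sa Ha c Sc Hc Delta _ HD; first by split.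
  by exists b.
(* The witnesses are recast as tuples from countable sets, so that [countable_tuples_of] applies;
   the membership added for [a_] follows from the first clause of [Q]. *)
rewrite (_ : SC L S = [set M : YL | forall n (eps : rat),
  [set e : rat | 0 < e] eps -> exists k, exists a_ : 'I_k -> 'I_n -> Y,
  tuples_of (tuples_of S n) k a_ /\ exists phi, tuples_of setT k phi /\
  exists delta, tuples_of setT k delta /\ @Q n eps k a_ phi delta M]).
  apply: borel_forall => n; apply: borel_forall_in; first exact: countableP.
  move=> eps _; apply: borel_exists => k.
  apply: borel_exists_in; first by do 2 apply: countable_tuples_of.
  move=> a_ _; apply: borel_exists_in.
    apply: countable_tuples_of; exact: countable_formula.
  move=> phi _; apply: borel_exists_in; last by move=> delta _; exact: bQ.
  apply: countable_tuples_of; exact: countableP.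
apply/seteqP; split=> M HM n eps eps0.
  have [k [a_ [phi [delta H]]]] := HM n eps eps0.
  exists k, a_; split; first by case: H => + _ _ i => /(_ i)[].
  by exists phi; split=> //; exists delta.
by have [k [a_ [_ [phi [_ [delta [_ H]]]]]]] := HM n eps eps0; exists k, a_, phi, delta.
Qed.

End structure_space_borel.

Theorem proposition5p3 (R : realType) (Y : metricType R) (S : set Y)
    (L : signature) (polishY : polish_metric Y)
    (d_le1 : forall x y : Y, mdist x y <= 1)
    (S_countable : countable S) (S_dense : dense S) :
  Iso_invariant S (SC L S) /\ borel (SC L S).
Proof.
split; first exact: SC_Iso_invariant.
exact: borel_SC.
Qed.
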